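(* Let $0<a<b$ be real numbers. The following hold. (1) If $0<y\leq 1$, then $$\frac{B(b,y)}{B(a,y)}\leq \frac{a}{b}\left(\frac{b^b(a+y)^{a+y}}{a^a(b+y)^{b+y}}\right)^{1-\frac{1}{y}}.$$ (2) If $y>1$, then $$\frac{a}{b}\left(\frac{b^b(a+y)^{a+y}}{a^a(b+y)^{b+y}}\right)^{1-\frac{1}{y}} \leq \frac{B(b,y)}{B(a,y)}.$$
   Context: For real $x,y>0$, $B(x,y)=\int_0^1 t^{x-1}(1-t)^{y-1}\,dt$ denotes the (Euler) beta function. *)

(* Defs.v *)
From mathcomp Require Import all_boot all_order all_algebra.
From mathcomp Require Import all_classical all_reals all_analysis.

Set Implicit Arguments.
Unset Strict Implicit.
Unset Printing Implicit Defensive.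

Import Order.TTheory GRing.Theory Num.Theory.
Import numFieldNormedType.Exports.

Local Open Scope classical_set_scope.
Local Open Scope ring_scope.

(* The library's beta_fun is only defined at natural parameters.  The domain is
   the open interval because powR gives 0 `^ r the conventional value 0 when
   r != 0.  The real-valued integral is only meaningful when the integrand is
   integrable, that is for 0 < x and 0 < y. *)
Definition euler_beta (R : realType) (x y : R) : R :=
  \int[@lebesgue_measure R]_(t in `]0, 1[) (t `^ (x - 1) * (1 - t) `^ (y - 1)).

(* Main.v *)
(* Fix [y] and let [g x] be the logarithm of [euler_beta x y] minus that of
   [(x^x / (x + y)^(x + y))^(1 - 1/y) / x]; one has to find the sign of
   [g b - g a].  The recurrence B(x + 1, y) = B(x, y) x / (x + y) makes the
   increment [g (x + 1) - g x] an elementary function of [x], whose derivative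
   is [1/y - 1] times a nonnegative quantity.  Hence the sequence
   [g (b + n) - g (a + n)] is monotone in [n], in a direction that depends on
   the sign of [1/y - 1]; since it tends to [0], its term at [n = 0] has a known
   sign. *)

Require Import Defs.
From mathcomp Require Import all_boot all_order all_algebra.
From mathcomp Require Import all_classical all_reals all_analysis measurable_realfun.
From mathcomp Require Import ring lra.

Set Implicit Arguments.
Unset Strict Implicit.
Unset Printing Implicit Defensive.

Import Order.TTheory GRing.Theory Num.Theory.
Import numFieldNormedType.Exports.

Local Open Scope classical_set_scope.
Local Open Scope ring_scope.

(** * The fundamental theorem of calculus on an open interval *)

Section improper_FTC.
Context {R : realType}.
Notation mu := (@lebesgue_measure R).
Variables (f F : R -> R) (a b : R).
Hypothesis ab : a < b.
Hypothesis cf : {in `]a, b[, continuous f}.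
Hypothesis dF : derivable_oo_LRcontinuous F a b.
Hypothesis F'f : {in `]a, b[, F^`()%classic =1 f}.

(** The compact intervals [S_ n] increase to the open interval, so that the usual theorem applies on
    each. The factor 1/3 keeps them nondegenerate already at [n = 0]. *)
Let e_ (n : nat) : R := (b - a) / 3 * n.+1%:R^-1.
Let S_ n : set R := `[a + e_ n, b - e_ n].

Let e_gt0 n : 0 < e_ n.
Proof. by rewrite mulr_gt0 ?divr_gt0 ?subr_gt0 ?invr_gt0. Qed.

Let e_le n : e_ n <= (b - a) / 3.
Proof.
by rewrite ler_piMr ?divr_ge0 ?subr_ge0 ?(ltW ab)// invf_le1 ?ler1n.
Qed.

Let e_cvg0 : e_ n @[n --> \oo] --> (0 : R).
Proof. by rewrite -(mulr0 ((b - a) / 3)); apply: cvgMr; exact: cvg_harmonic. Qed.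

Let S_sub n : S_ n `<=` `]a, b[.
Proof.
move=> x; rewrite /S_ /= !in_itv/= => /andP[ax xb]; have := e_gt0 n.
by move=> ?; apply/andP; split; lra.
Qed.

Let S_lt n : a + e_ n < b - e_ n.
Proof. have := e_le n; move: ab => ? ?; lra. Qed.

Let S_near x : x \in `]a, b[ -> \forall n \near \oo, S_ n x.
Proof.
rewrite in_itv/= => /andP[ax xb]; near=> n.
have h1 : e_ n <= x - a.
  by near: n; apply: (cvgr_le _ e_cvg0); rewrite subr_gt0.
have h2 : e_ n <= b - x.
  by near: n; apply: (cvgr_le _ e_cvg0); rewrite subr_gt0.
by rewrite /S_ /= in_itv/=; apply/andP; split; lra.
Unshelve. all: by end_near. Qed.

Let S_nd : nondecreasing_seq S_.
Proof.
move=> m n mn; rewrite subsetEset => x; rewrite /S_ /= !in_itv/= => /andP[h1 h2].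
have emn : e_ n <= e_ m.
  rewrite ler_wpM2l ?divr_ge0 ?subr_ge0 ?(ltW ab)//.
  by rewrite lef_pV2 ?posrE// ler_nat.
by apply/andP; split; lra.
Qed.

Let S_bigcup : \bigcup_n S_ n = `]a, b[%classic.
Proof.
apply/seteqP; split => [x [n _]|x xab]; first exact: S_sub.
by have [n _ /(_ n (leqnn n)) h] := S_near xab; exists n.
Qed.

Let mf : measurable_fun `]a, b[ f.
Proof.
by apply: open_continuous_measurable_fun => // x; rewrite inE; exact: cf.
Qed.

Let FTC_S n :
  (\int[mu]_(x in S_ n) (f x)%:E = (F (b - e_ n) - F (a + e_ n))%:E)%E.
Proof.
have [dFab _ _] := dF.
rewrite EFinB; apply: continuous_FTC2 => //.
- apply: continuous_in_subspaceT => x xS; apply: cf.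
  by apply: (@S_sub n); rewrite inE in xS.
- have Fc : {within `[a + e_ n, b - e_ n], continuous F}.
    apply: derivable_within_continuous => x xS; apply: dFab.
    exact: (@S_sub n).
  have [_ Fl Fr] := (continuous_within_itvP _ (S_lt n)).1 Fc.
  split => // x xS; apply: dFab; apply: (@S_sub n).
  exact: subset_itv_oo_cc.
- move=> x xS; apply: F'f; apply: (@S_sub n).
  exact: subset_itv_oo_cc.
Qed.

Let F_cvg : F (b - e_ n) - F (a + e_ n) @[n --> \oo] --> F b - F a.
Proof.
have [_ Fa Fb] := dF; apply: cvgB.
- apply: (cvg_at_leftP F b (F b)).1 => //; split.
    by move=> n; rewrite ltrBlDr ltrDl.
  by rewrite -[X in _ --> X]subr0; apply: cvgB => //; exact: cvg_cst.
- apply: (cvg_at_rightP F a (F a)).1 => //; split.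
    by move=> n; rewrite ltrDl.
  by rewrite -[X in _ --> X]addr0; apply: cvgD => //; exact: cvg_cst.
Qed.

Let EF_cvg : (F (b - e_ n) - F (a + e_ n))%:E @[n --> \oo] --> (F b - F a)%:E.
Proof. by apply: cvg_EFin => //; exact: nearW. Qed.

(** By monotone convergence, the integral of [f] is the limit of the increments of [F] over [S_ n],
    which is the finite number [F b - F a]. *)
Lemma ge0_integrable_derive_oo : (forall x, x \in `]a, b[ -> 0 <= f x) ->
  mu.-integrable `]a, b[ (EFin \o f).
Proof.
move=> f0; apply/integrableP; split; first exact/measurable_EFinP.
have -> : (\int[mu]_(x in `]a, b[) `|(EFin \o f) x| =
           \int[mu]_(x in `]a, b[) (f x)%:E)%E.
  by apply: eq_integral => x /[1!inE] xab; rewrite gee0_abs ?lee_fin ?f0.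
suff -> : (\int[mu]_(x in `]a, b[) (f x)%:E = (F b - F a)%:E)%E by rewrite ltry.
rewrite -S_bigcup.
have h : (\int[mu]_(x in S_ i) (f x)%:E)%E @[i --> \oo] -->
    (\int[mu]_(x in \bigcup_i S_ i) (f x)%:E)%E.
  apply: ge0_nondecreasing_set_cvg_integral => //.
  - by move=> i; exact: measurable_itv.
  - by move=> i; apply/measurable_EFinP; exact: measurable_funS mf.
  - by move=> i x /S_sub xab; rewrite lee_fin f0.
rewrite (eq_cvg _ _ FTC_S) in h.
by apply: (cvg_unique _ h) => //; exact: EF_cvg.
Qed.

(** Here [f] may change sign, so monotone convergence gives way to dominated convergence: the
    restrictions of [f] to [S_ n] are dominated by the absolute value of [f]. *)
Lemma Rintegral_FTC2_oo : mu.-integrable `]a, b[ (EFin \o f) ->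
  \int[mu]_(x in `]a, b[) f x = F b - F a.
Proof.
move=> fi.
have := @dominated_convergence _ _ _ mu `]a, b[ (measurable_itv _)
  (fun n => (EFin \o f) \_ (S_ n)) (EFin \o f) (abse \o (EFin \o f)).
case.
- move=> n; apply/measurable_restrict => //; first exact: measurable_itv.
  by apply/measurable_EFinP; apply: measurable_funS mf => // x [].
- exact/measurable_EFinP.
- apply: aeW => x xab; apply: cvg_near_cst.
  by near=> n; rewrite patchE mem_set//; near: n; exact: S_near.
- exact: integrable_abse.
- apply: aeW => x n xab; rewrite patchE; case: ifPn => // _.
  (* Outside [S_ n] the restriction takes the default value [point], which is 0 in the extended
     reals. *)
  by rewrite (_ : point = 0%E)// abse0 abse_ge0.
move=> _ _ h.
rewrite /Rintegral; suff -> : (\int[mu]_(x in `]a, b[) (f x)%:E = (F b - F a)%:E)%E by [].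
have FTC_S' n : (\int[mu]_(x in `]a, b[) ((EFin \o f) \_ (S_ n)) x =
    (F (b - e_ n) - F (a + e_ n))%:E)%E.
  by rewrite -FTC_S -integral_mkcondr setIidr.
rewrite (eq_cvg _ _ FTC_S') in h.
by apply: (cvg_unique _ h) => //; exact: EF_cvg.
Unshelve. all: by end_near. Qed.

End improper_FTC.

(** * Regularity and integrability of the beta integrand *)

Section beta_integrand.
Context {R : realType}.
Notation mu := (@lebesgue_measure R).
Implicit Types x y t : R.

Lemma is_derive1_continuous (f : R -> R) (x d : R) :
  is_derive x 1 f d -> {for x, continuous f}.
Proof.
by move=> df; apply/differentiable_continuous/derivable1_diffP; exact: ex_derive.
Qed.

Lemma is_derive1_powR_onem y t : t < 1 ->
  is_derive t 1 (fun s => (1 - s) `^ y) (- (y * (1 - t) `^ (y - 1))).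
Proof.
move=> t1; have t1' : 0 < 1 - t by rewrite subr_gt0.
have h : is_derive t 1 (fun s : R => 1 - s) (-1).
  by apply: is_derive_eq; rewrite add0r mul1r.
have := @is_derive1_comp R (fun s => s `^ y) (fun s => 1 - s) t _ _
  (is_derive1_powR y t1') h.
by rewrite mulrN1.
Qed.

Lemma powR_LRcontinuous x : 0 < x ->
  derivable_oo_LRcontinuous (@powR R ^~ x) (0 : R) 1.
Proof.
move=> x0; split.
- by move=> t; rewrite in_itv/= => /andP[t0 _]; apply: ex_derive; exact: is_derive1_powR.
- by rewrite powR0 ?gt_eqF//; exact: powR_cvg0.
- apply: cvg_at_left_filter.
  exact: (is_derive1_continuous (is_derive1_powR x ltr01)).
Qed.

Lemma powR_onem_LRcontinuous y : 0 < y ->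
  derivable_oo_LRcontinuous (fun t => (1 - t) `^ y) (0 : R) 1.
Proof.
move=> y0; split.
- move=> t; rewrite in_itv/= => /andP[_ t1].
  by apply: ex_derive; exact: is_derive1_powR_onem.
- apply: cvg_at_right_filter.
  exact: (is_derive1_continuous (is_derive1_powR_onem y ltr01)).
- rewrite subrr powR0 ?gt_eqF//; apply/cvg_at_leftP => u [u1 ucvg].
  apply: (cvg_at_rightP (@powR R ^~ y) 0 0).1; first exact: powR_cvg0.
  split=> [n|]; first by rewrite subr_gt0.
  by rewrite -(subrr 1); apply: cvgB => //; exact: cvg_cst.
Qed.

Lemma continuous_beta_integrand x y :
  {in `]0, 1[, continuous (fun t : R => t `^ x * (1 - t) `^ y)}.
Proof.
move=> t; rewrite in_itv/= => /andP[t0 t1].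
have h := is_deriveM (is_derive1_powR x t0) (is_derive1_powR_onem y t1).
exact: (is_derive1_continuous h).
Qed.

Lemma beta_integrand_ge0 x y t : 0 <= t `^ x * (1 - t) `^ y.
Proof. by rewrite mulr_ge0 ?powR_ge0. Qed.

(** The integrand is dominated by [g], which has one singular term for each endpoint. The primitive
    [G] of [g] is continuous up to both endpoints because the exponents [x] and [y] are positive. *)
Lemma beta_integrable x y : 0 < x -> 0 < y ->
  mu.-integrable `]0, 1[
    (EFin \o (fun t => t `^ (x - 1) * (1 - t) `^ (y - 1))).
Proof.
move=> x0 y0.
pose g t := t `^ (x - 1) + (1 - t) `^ (y - 1).
pose G t := t `^ x * x^-1 - (1 - t) `^ y * y^-1.
have dG t : t \in `]0, 1[ -> is_derive t 1 G (g t).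
  rewrite in_itv/= => /andP[t0 t1].
  have h1 : is_derive t 1 (@powR R ^~ x) (x * t `^ (x - 1)) by exact: is_derive1_powR.
  have h2 := is_derive1_powR_onem y t1.
  apply: is_derive_eq.
  rewrite !scaler0 !add0r /GRing.scale/= /g; field.
  by rewrite !gt_eqF.
have gi : mu.-integrable `]0, 1[ (EFin \o g).
  apply: (@ge0_integrable_derive_oo _ _ G) => //.
  - move=> t; rewrite in_itv/= => /andP[t0 t1].
    have h := is_deriveD (is_derive1_powR (x - 1) t0) (is_derive1_powR_onem (y - 1) t1).
    exact: (is_derive1_continuous h).
  - have [_ ? ?] := powR_LRcontinuous x0.
    have [_ ? ?] := powR_onem_LRcontinuous y0.
    split.
    + by move=> t /dG ?; exact: ex_derive.
    + by apply: cvgB; apply: cvgM => //; exact: cvg_cst.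
    + by apply: cvgB; apply: cvgM => //; exact: cvg_cst.
  - by move=> t /dG ?; rewrite derive1E derive_val.
  - by move=> t _; rewrite addr_ge0 ?powR_ge0.
apply: le_integrable gi => //.
  apply/measurable_EFinP; apply: open_continuous_measurable_fun => // t.
  by rewrite inE; exact: continuous_beta_integrand.
move=> t /=; rewrite in_itv/= => /andP[t0 t1].
rewrite lee_fin !ger0_norm ?beta_integrand_ge0 ?addr_ge0 ?powR_ge0//.
set p := t `^ (x - 1); set q := (1 - t) `^ (y - 1).
(* the integrand splits as [pq = pq(1 - t) + pqt] *)
have -> : p * q = p * ((1 - t) * q) + q * (t * p) by ring.
have t0' := ltW t0; have t1' : 0 <= 1 - t by rewrite subr_ge0 ltW.
rewrite !mulr_powRB1//.
have le1 (s z : R) : 0 < s -> s < 1 -> 0 < z -> s `^ z <= 1.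
  by move=> s0 s1 z0; rewrite -(powRr0 s) ger_powR ?s0 ?(ltW s1) ?ltW.
by rewrite lerD// ler_piMr ?powR_ge0// le1// ?subr_gt0// gtrBl.
Qed.

End beta_integrand.

(** * Monotonicity, positivity and recurrence of the beta function *)

Section beta.
Context {R : realType}.
Notation mu := (@lebesgue_measure R).
Implicit Types x y t : R.

Lemma euler_beta_nincr x x' y : 0 < x -> 0 < y -> x <= x' ->
  euler_beta x' y <= euler_beta x y.
Proof.
move=> x0 y0 xx'; apply: le_Rintegral => //.
- by apply: beta_integrable => //; exact: lt_le_trans xx'.
- exact: beta_integrable.
- move=> t /=; rewrite in_itv/= => /andP[t0 t1].
  by rewrite ler_wpM2r ?powR_ge0// ger_powR ?t0 ?(ltW t1)// lerB.
Qed.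

(** If the integral vanished, the nonnegative integrand would be zero almost everywhere, whereas it
    is positive on all of []0, 1[], a set of measure 1. *)
Lemma euler_beta_gt0 x y : 0 < x -> 0 < y -> 0 < euler_beta x y.
Proof.
move=> x0 y0; have bi := beta_integrable x0 y0.
rewrite lt0r; apply/andP; split; last first.
  by apply: Rintegral_ge0 => t _; exact: beta_integrand_ge0.
apply/eqP; rewrite /euler_beta /Rintegral => B0.
have : (\int[mu]_(t in `]0%R, 1%R[)
    `|(t `^ (x - 1) * (1 - t) `^ (y - 1))%:E| = 0)%E.
  under eq_integral do rewrite gee0_abs ?lee_fin ?beta_integrand_ge0//.
  rewrite -[LHS]fineK; last by apply: integrable_fin_num bi.
  by rewrite /= B0.
have mw := measurable_int _ bi.
move=> /(ae_eq_integral_abs mu (measurable_itv _) mw)[N [mN N0 sN]].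
have : (mu `]0%R, 1%R[ <= mu N)%E.
  apply: le_measure; rewrite ?inE//.
  apply: subset_trans sN => t t01 /(_ t01).
  move: t01; rewrite /= in_itv/= => /andP[t0 t1] /eqP.
  by rewrite eqe gt_eqF// mulr_gt0// powR_gt0// subr_gt0.
by rewrite N0 lebesgue_measure_itv/= lte_fin ltr01 oppr0 adde0 lee_fin ler10.
Qed.

(** The function [F] below vanishes at 0 and 1, and its derivative [f] integrates to [x] B(x, y) -
    (x + y) B(x + 1, y), which is therefore zero. *)
Lemma euler_betaS x y : 0 < x -> 0 < y ->
  euler_beta (x + 1) y = euler_beta x y * (x / (x + y)).
Proof.
move=> x0 y0.
have x10 : 0 < x + 1 by rewrite addr_gt0.
have bi := beta_integrable x0 y0; have bi1 := beta_integrable x10 y0.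
pose f t : R := x * (t `^ (x - 1) * (1 - t) `^ (y - 1)) -
  (x + y) * (t `^ (x + 1 - 1) * (1 - t) `^ (y - 1)).
pose F t : R := t `^ x * (1 - t) `^ y.
have dF t : t \in `]0, 1[ -> is_derive t 1 F (f t).
  rewrite in_itv/= => /andP[t0 t1].
  have h1 : is_derive t 1 (@powR R ^~ x) (x * t `^ (x - 1)) by exact: is_derive1_powR.
  have h2 := is_derive1_powR_onem y t1.
  apply: is_derive_eq; rewrite /GRing.scale/= /f addrK.
  rewrite -(mulr_powRB1 (ltW t0) x0) -(@mulr_powRB1 _ (1 - t) y) ?subr_ge0 ?(ltW t1)//.
  by ring.
have fi1 : mu.-integrable `]0, 1[
    (EFin \o (fun t => x * (t `^ (x - 1) * (1 - t) `^ (y - 1)))).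
  exact: (integrableZl _ x bi).
have fi2 : mu.-integrable `]0, 1[
    (EFin \o (fun t => (x + y) * (t `^ (x + 1 - 1) * (1 - t) `^ (y - 1)))).
  exact: (integrableZl _ (x + y) bi1).
have : \int[mu]_(t in `]0, 1[) f t = F 1 - F 0.
  apply: Rintegral_FTC2_oo => //.
  - move=> t t01; have h z := @continuous_beta_integrand R z (y - 1) t t01.
    exact: (cvgB (cvgMr (h (x - 1))) (cvgMr (h (x + 1 - 1)))).
  - have [_ ? ?] := powR_LRcontinuous x0.
    have [_ ? ?] := powR_onem_LRcontinuous y0.
    split; [by move=> t /dF ?; exact: ex_derive|exact: cvgM|exact: cvgM].
  - by move=> t /dF ?; rewrite derive1E derive_val.
  - exact: (integrableB _ fi1 fi2).
rewrite /F subrr !powR0 ?gt_eqF// mulr0 mul0r subrr.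
rewrite RintegralB// !RintegralZl// -/(euler_beta x y) -/(euler_beta (x + 1) y).
move=> /eqP; rewrite subr_eq0 => /eqP h.
have xy : x + y != 0 by rewrite gt_eqF ?addr_gt0.
by apply: (mulfI xy); rewrite -h; field.
Qed.

End beta.

(** * Logarithmic estimates and the elementary increment *)

Section comparison.
Context {R : realType}.
Implicit Types a b c x y h : R.

Lemma ln_increment_bound x h : 0 < x -> 0 <= h -> 0 <= ln (x + h) - ln x <= h / x.
Proof.
move=> x0 h0; have xh : 0 < x + h by rewrite ltr_pwDl.
rewrite subr_ge0 ler_ln ?posrE// lerDl h0 /= -ln_div ?posrE//.
rewrite mulrDl divff ?gt_eqF// le_ln1Dx// (lt_le_trans (ltrN10 _))//.
by rewrite divr_ge0 // ltW.
Qed.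

Lemma cvg_divDn a c : 0 < a -> c / (a + n%:R) @[n --> \oo] --> (0 : R).
Proof.
move=> a0; rewrite -[X in _ --> X](mulr0 c); apply: cvgMr.
apply/gtr0_cvgV0; first by apply: nearW => n; rewrite ltr_pwDl.
by apply: (cvg_comp (fun n => n%:R) (fun x => a + x)); [exact: cvgr_idn|exact: cvg_addrl].
Qed.

(** The logarithm of x^x / (x + y)^(x + y). *)
Let psi y x := x * ln x - (x + y) * ln (x + y).

Let is_derive_psi y x : 0 < x -> 0 < y ->
  is_derive x 1 (psi y) (ln x - ln (x + y)).
Proof.
move=> x0 y0; have xy : 0 < x + y by rewrite addr_gt0.
have h1 := is_derive1_ln x0.
have hs : is_derive x 1 (fun z : R => z + y) 1.
  by apply: is_derive_eq; rewrite addr0.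
have h2 := @is_derive1_comp R (@ln R) (fun z => z + y) x _ _ (is_derive1_ln xy) hs.
rewrite /comp/= in h2.
apply: is_derive_eq; rewrite /GRing.scale/= ; field.
by rewrite !gt_eqF.
Qed.

(** By the mean value theorem the difference is [b - a] times [ln c - ln (c + y)] for some [c] above
    [a + n], and this factor lies between [- (y / (a + n))] and 0. *)
Let psi_shift_cvg a b y : 0 < a -> a < b -> 0 < y ->
  psi y (b + n%:R) - psi y (a + n%:R) @[n --> \oo] --> 0.
Proof.
move=> a0 ab y0.
apply: (squeeze_cvgr (f := fun n => - (y * (b - a)) / (a + n%:R)) (h := fun=> 0)).
- apply: nearW => n.
  have an0 : 0 < a + n%:R by rewrite ltr_pwDl.
  have abn : a + n%:R < b + n%:R by rewrite ltrD2r.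
  have pos x : x \in `]a + n%:R, b + n%:R[ -> 0 < x.
    by rewrite in_itv/= => /andP[+ _]; exact: lt_trans.
  have dpsi x : x \in `]a + n%:R, b + n%:R[ ->
    is_derive x 1 (psi y) (ln x - ln (x + y)).
    by move=> /pos x0; exact: is_derive_psi.
  have cpsi : {within `[a + n%:R, b + n%:R], continuous (psi y)}.
    apply: derivable_within_continuous => x.
    rewrite in_itv/= => /andP[/(lt_le_trans an0) x0 _].
    by have d := is_derive_psi x0 y0; exact: ex_derive.
  have [c cab ->] := MVT abn dpsi cpsi.
  rewrite opprD addrACA subrr addr0.
  have /andP[l0 ly] := ln_increment_bound (pos _ cab) (ltW y0).
  have yc : y / c <= y / (a + n%:R).
    rewrite ler_wpM2l ?(ltW y0)// lef_pV2 ?posrE ?(pos _ cab)//.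
    by move: cab; rewrite in_itv/= => /andP[/ltW].
  have ba : 0 <= b - a by rewrite subr_ge0 ltW.
  have := mulr_ge0 l0 ba; have := ler_wpM2r ba (le_trans ly yc).
  by rewrite mulNr mulrAC => ? ?; apply/andP; split; lra.
- exact: cvg_divDn.
- exact: cvg_cst.
Qed.

(** The increment over a unit step of ln B(x, y) + ln x - (1 - 1/y) [psi y x], once the recurrence
    has eliminated B; the two terms [ln x] cancel. *)
Let delta y x := ln (x + 1) - ln (x + y) - (1 - 1 / y) * (psi y (x + 1) - psi y x).

(** The factor [1 / y - 1] comes out of the first two terms of [delta] as well, since 1/(x + 1) -
    1/(x + y) = (y - 1)/((x + 1)(x + y)). *)
Let delta' y x := (1 / y - 1) *
  (ln ((x + 1) * (x + y)) - ln (x * (x + 1 + y)) - y / ((x + 1) * (x + y))).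

Let is_derive_delta y x : 0 < x -> 0 < y -> is_derive x 1 (delta y) (delta' y x).
Proof.
move=> x0 y0; have xy : 0 < x + y by rewrite addr_gt0.
have x1 : 0 < x + 1 by rewrite addr_gt0.
have hs z : is_derive x 1 (fun s : R => s + z) 1.
  by apply: is_derive_eq; rewrite addr0.
have h1 := @is_derive1_comp R (@ln R) (fun z => z + 1) x _ _ (is_derive1_ln x1) (hs 1).
have h2 := @is_derive1_comp R (@ln R) (fun z => z + y) x _ _ (is_derive1_ln xy) (hs y).
have h3 := is_derive_psi x0 y0.
have h4 := @is_derive1_comp R (psi y) (fun z => z + 1) x _ _ (is_derive_psi x1 y0) (hs 1).
rewrite /comp/= in h1 h2 h4.
apply: is_derive_eq; rewrite /delta' !lnM ?posrE ?addr_gt0// /GRing.scale/=.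
by field; rewrite !gt_eqF.
Qed.

(* The bracket in the derivative of [delta] is [- ln (1 - u) - u >= 0] for
   [u = y / ((x + 1) (x + y))], since [(x + 1) (x + y) - y = x (x + 1 + y)]. *)
Let delta_increment a b y : 0 < a -> a < b -> 0 < y ->
  exists2 k, 0 <= k & delta y b - delta y a = (1 / y - 1) * k.
Proof.
move=> a0 ab y0.
have ddelta x : x \in `]a, b[ -> is_derive x 1 (delta y) (delta' y x).
  by rewrite in_itv/= => /andP[/(lt_trans a0) x0 _]; exact: is_derive_delta.
have cdelta : {within `[a, b], continuous (delta y)}.
  apply: derivable_within_continuous => x.
  rewrite in_itv/= => /andP[/(lt_le_trans a0) x0 _].
  by have d := is_derive_delta x0 y0; exact: ex_derive.
have [c + ->] := MVT ab ddelta cdelta.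
rewrite in_itv/= => /andP[/(lt_trans a0) c0 _]; rewrite /delta' -mulrA.
eexists; last by reflexivity.
rewrite mulr_ge0 ?subr_ge0 ?(ltW ab)//.
have P0 : 0 < (c + 1) * (c + y) by rewrite mulr_gt0 ?addr_gt0.
have Q0 : 0 < c * (c + 1 + y) by rewrite mulr_gt0 ?addr_gt0.
have u1 : - 1 < - (y / ((c + 1) * (c + y))).
  rewrite ltrN2 ltr_pdivrMr// mul1r.
  by have := mulr_gt0 c0 c0; have := mulr_gt0 c0 y0; lra.
have := le_ln1Dx u1.
have -> : 1 + - (y / ((c + 1) * (c + y))) = c * (c + 1 + y) / ((c + 1) * (c + y)).
  by field; rewrite !gt_eqF ?addr_gt0.
by rewrite ln_div ?posrE//; lra.
Qed.

(** * Ratio bounds for a positive nonincreasing function satisfying the beta recurrence *)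

Variables (B : R -> R) (y a b : R).
Hypotheses (y0 : 0 < y) (a0 : 0 < a) (ab : a < b).
Hypothesis B_gt0 : forall x, 0 < x -> 0 < B x.
Hypothesis B_nincr : forall x x', 0 < x -> x <= x' -> B x' <= B x.
Hypothesis BS : forall x, 0 < x -> B (x + 1) = B x * (x / (x + y)).

Let lnBS x : 0 < x -> ln (B (x + 1)) = ln (B x) + ln x - ln (x + y).
Proof.
move=> x0; have xy : 0 < x + y by rewrite addr_gt0.
by rewrite BS// lnM ?posrE ?B_gt0 ?divr_gt0// ln_div ?posrE// addrA.
Qed.

(** Each of the [m] unit steps lowers [ln B] by [ln (x + k + y) - ln (x + k)], which is at most
    [y / x]. *)
Let lnB_shift_le x m : 0 < x -> ln (B x) - ln (B (x + m%:R)) <= m%:R * (y / x).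
Proof.
move=> x0; elim: m => [|m IH]; first by rewrite addr0 subrr mul0r.
have xm : 0 < x + m%:R by rewrite ltr_pwDl.
rewrite -natr1 addrA lnBS//.
have /andP[_ h] := ln_increment_bound xm (ltW y0).
have : y / (x + m%:R) <= y / x by rewrite ler_wpM2l ?(ltW y0)// lef_pV2 ?posrE// lerDl.
rewrite mulrDl mul1r; move: IH h; lra.
Qed.

(** With an integer [m] at least [b - a], monotonicity puts [B (b + n)] between [B (a + n + m)] and
    [B (a + n)], whose logarithms differ by at most [m * y / (a + n)]. *)
Let lnB_shift_cvg : ln (B (b + n%:R)) - ln (B (a + n%:R)) @[n --> \oo] --> 0.
Proof.
pose m := Num.bound (b - a).
have bam : b <= a + m%:R.
  by rewrite -lerBlDl ltW// archi_boundP// subr_ge0 ltW.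
apply: (squeeze_cvgr (f := fun n => - (m%:R * y) / (a + n%:R)) (h := fun=> 0)).
- apply: nearW => n.
  have an0 : 0 < a + n%:R by rewrite ltr_pwDl.
  have b0 := lt_trans a0 ab.
  have bn0 : 0 < b + n%:R by rewrite ltr_pwDl.
  rewrite subr_le0 ler_ln ?posrE ?B_gt0// B_nincr ?lerD2r ?(ltW ab)// andbT.
  have := lnB_shift_le m an0.
  have : ln (B (a + n%:R + m%:R)) <= ln (B (b + n%:R)).
    rewrite ler_ln ?posrE ?B_gt0 ?ltr_pwDl//.
    by apply: B_nincr => //; rewrite addrAC lerD2r.
  rewrite mulNr mulrA; lra.
- exact: cvg_divDn.
- exact: cvg_cst.
Qed.

(** The sequence whose limit is 0 and whose first term is to be signed: the gap between [b + n] and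
    [a + n] of the function whose unit increment is [delta y]. *)
Let g n := (ln (B (b + n%:R)) - ln (B (a + n%:R)))
  + (ln (b + n%:R) - ln (a + n%:R))
  - (1 - 1 / y) * (psi y (b + n%:R) - psi y (a + n%:R)).

Let g_cvg0 : g n @[n --> \oo] --> 0.
Proof.
(* The limit 0 is spelled as [0 + 0 - (1 - 1 / y) * 0] to match the three groups of terms of [g]. *)
rewrite -[X in _ --> X](addr0 0) -[X in _ --> _ + X]oppr0 -[X in _ --> X - _](addr0 0).
rewrite -[X in _ --> _ - X](mulr0 (1 - 1 / y)).
apply: cvgB; last by apply: cvgMr; exact: psi_shift_cvg.
apply: cvgD; first exact: lnB_shift_cvg.
apply: (squeeze_cvgr (f := fun=> 0) (h := fun n => (b - a) / (a + n%:R))).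
- apply: nearW => n; have an0 : 0 < a + n%:R by rewrite ltr_pwDl.
  have := @ln_increment_bound (a + n%:R) (b - a) an0.
  by rewrite addrAC subrKC; apply; rewrite subr_ge0 ltW.
- exact: cvg_cst.
- exact: cvg_divDn.
Qed.

(** Exchanging the two differences, the step of [g] at [n] is
    [delta y (b + n) - delta y (a + n)]. *)
Let gS n : exists2 k, 0 <= k & g n.+1 - g n = (1 / y - 1) * k.
Proof.
have an0 : 0 < a + n%:R by rewrite ltr_pwDl.
have b0 := lt_trans a0 ab.
have bn0 : 0 < b + n%:R by rewrite ltr_pwDl.
have abn : a + n%:R < b + n%:R by rewrite ltrD2r.
have [k k0 kE] := delta_increment an0 abn y0.
exists k => //; rewrite -kE /g /delta -natr1 !addrA !lnBS//.
by ring.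
Qed.

Local Notation q := (a / b *
  ((b `^ b * (a + y) `^ (a + y)) / (a `^ a * (b + y) `^ (b + y))) `^ (1 - 1 / y)).

Let q_gt0 : 0 < q.
Proof.
have b0 := lt_trans a0 ab.
have p0 x z : 0 < x -> 0 < x `^ z by exact: powR_gt0.
by rewrite mulr_gt0 ?divr_gt0// p0// divr_gt0// mulr_gt0// p0// addr_gt0.
Qed.

Let g0E : g 0 = ln (B b / B a) - ln q.
Proof.
have b0 := lt_trans a0 ab.
have ay0 : 0 < a + y by rewrite addr_gt0.
have by0 : 0 < b + y by rewrite addr_gt0.
have p0 x z : 0 < x -> x `^ z \is Num.pos by move=> x0; rewrite posrE powR_gt0.
rewrite /g !addr0 ln_div ?posrE ?B_gt0// lnM ?posrE ?divr_gt0 ?powR_gt0 ?divr_gt0 ?mulr_gt0 ?powR_gt0//.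
rewrite ln_powR !ln_div ?lnM ?posrE ?mulr_gt0 ?powR_gt0// !ln_powR /psi.
by ring.
Qed.

Let ratio_gt0 : 0 < B b / B a.
Proof. by rewrite divr_gt0 ?B_gt0// (lt_trans a0). Qed.

Lemma ratio_le_of_shift : y <= 1 -> B b / B a <= q.
Proof.
move=> y1; rewrite -ler_ln ?posrE// -subr_le0 -g0E.
have nd : nondecreasing_seq g.
  apply/nondecreasing_seqP => n; rewrite -subr_ge0.
  have [k k0 ->] := gS n.
  by rewrite mulr_ge0// subr_ge0 div1r invf_ge1.
(* Reading 0 as the limit of [g] turns the goal into the bound of a term of a nondecreasing sequence
   by its limit. *)
rewrite -(cvg_lim (@Rhausdorff R) g_cvg0).
by apply: nondecreasing_cvgn_le => //; apply/cvg_ex; exists 0.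
Qed.

Lemma ratio_ge_of_shift : 1 <= y -> q <= B b / B a.
Proof.
move=> y1; rewrite -ler_ln ?posrE// -subr_ge0 -g0E.
have ni : nonincreasing_seq g.
  apply/nonincreasing_seqP => n; rewrite -subr_le0.
  have [k k0 ->] := gS n.
  by rewrite mulr_le0_ge0// subr_le0 div1r invf_le1.
rewrite -(cvg_lim (@Rhausdorff R) g_cvg0).
by apply: nonincreasing_cvgn_ge => //; apply/cvg_ex; exists 0.
Qed.

End comparison.

Theorem theorem2p9 (R : realType) (a b : R) (ha : 0 < a) (hab : a < b) :
  (forall y : R, 0 < y -> y <= 1 ->
     euler_beta b y / euler_beta a y <=
     (a / b) *
     ((b `^ b * (a + y) `^ (a + y)) / (a `^ a * (b + y) `^ (b + y)))
       `^ (1 - 1 / y))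
  /\
  (forall y : R, 1 < y ->
     (a / b) *
     ((b `^ b * (a + y) `^ (a + y)) / (a `^ a * (b + y) `^ (b + y)))
       `^ (1 - 1 / y)
     <= euler_beta b y / euler_beta a y).
Proof.
split=> y.
- move=> y0 y1; apply: (@ratio_le_of_shift R (fun x => euler_beta x y)) => // [x x0|x x' x0|x x0].
  + exact: euler_beta_gt0.
  + exact: euler_beta_nincr.
  + exact: euler_betaS.
- move=> y1; have y0 := lt_trans ltr01 y1.
  apply: (@ratio_ge_of_shift R (fun x => euler_beta x y)) => // [x x0|x x' x0|x x0|].
  + exact: euler_beta_gt0.
  + exact: euler_beta_nincr.
  + exact: euler_betaS.
  + exact: ltW.
Qed.
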